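(* Let $G$ be a connected Lie group with (finite-dimensional real) Lie algebra $\mathfrak{g}$, let $\langle\cdot,\cdot\rangle$ be a positive-definite inner product on $\mathfrak{g}$, and let $g$ be the corresponding left-invariant Riemannian metric on $G$. Let $\divideontimes$ be the product on $\mathfrak{g}$ given by $X\divideontimes Y:=U(X,Y)$, where $U$ is the symmetric part of the Levi-Civita connection of $(\mathfrak{g},\langle\cdot,\cdot\rangle)$. If $\divideontimes$ is associative, then $X\divideontimes Y=0$ for all $X,Y\in\mathfrak{g}$; consequently the metric $g$ is bi-invariant.
   Context: Let $\mathfrak{g}$ be the Lie algebra of left-invariant vector fields on $G$. An inner product (more generally, a nondegenerate symmetric bilinear form) $\langle\cdot,\cdot\rangle$ on $\mathfrak{g}$ determines a unique left-invariant metric $g$ on $G$ with $g(X,Y)=\langle X,Y\rangle$ for $X,Y\in\mathfrak{g}$. The Levi-Civita connection restricts to a bilinear map $\nabla:\mathfrak{g}\times\mathfrak{g}\to\mathfrak{g}$, which decomposes as $\nabla_XY=\frac12[X,Y]+U(X,Y)$, where the symmetric bilinear map $U:\mathfrak{g}\times\mathfrak{g}\to\mathfrak{g}$ is determined by $$2\langle U(X,Y),Z\rangle=\langle[Z,X],Y\rangle+\langle[Z,Y],X\rangle\qquad\text{for all }X,Y,Z\in\mathfrak{g}.$$ The metric $g$ is bi-invariant if both left and right translations of $G$ are isometries (for $G$ connected this is equivalent to $\operatorname{ad}_X$ being skew-symmetric with respect to $\langle\cdot,\cdot\rangle$ for all $X\in\mathfrak{g}$). *)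

(* Defs.v *)
From HB Require Import structures.
From mathcomp Require Import all_boot all_order all_algebra.
From mathcomp Require Import all_classical all_reals all_analysis.

Set Implicit Arguments.
Unset Strict Implicit.
Unset Printing Implicit Defensive.

Import Order.TTheory GRing.Theory Num.Theory.
Import numFieldNormedType.Exports.

Local Open Scope classical_set_scope.
Local Open Scope ring_scope.

(* Used with V finite-dimensional and A open: f is C^(k+1) iff it is
   differentiable and all its directional derivatives are C^k. *)
Fixpoint Ck_on (R : realType) (V W : normedModType R) (k : nat)
    (A : set V) (f : V -> W) : Prop :=
  match k with
  | 0%N => forall x, A x -> {for x, continuous f}
  | k'.+1 => (forall x, A x -> differentiable f x) /\
             (forall v, Ck_on k' A (fun x => 'D_v f x))
  end.

Definition smooth_on (R : realType) (V W : normedModType R)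
    (A : set V) (f : V -> W) : Prop :=
  forall k, Ck_on k A f.

(* A smooth n-manifold, given by a smooth atlas indexed by the points: chart p
   is a homeomorphism, with inverse chartV p, from an open neighbourhood
   chart_dom p of p onto an open set chart_cod p of R^n.  (Indexing by points
   loses no generality: choose a chart around each point.) Outside chart_dom p
   and chart_cod p the values of chart p and chartV p are irrelevant. *)
HB.mixin Record isManifold (R : realType) (n : nat) M of Topological M := {
  chart_dom : M -> set M;
  chart_cod : M -> set 'rV[R]_n;
  chart : M -> M -> 'rV[R]_n;
  chartV : M -> 'rV[R]_n -> M;
  manifold_hausdorff : hausdorff_space M;
  manifold_second_countable : @second_countable M;
  chart_dom_open : forall p, open (chart_dom p);
  chart_cod_open : forall p, open (chart_cod p);
  chart_dom_self : forall p, chart_dom p p;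
  chart_funS : forall p q, chart_dom p q -> chart_cod p (chart p q);
  chartV_funS : forall p x, chart_cod p x -> chart_dom p (chartV p x);
  chartK : forall p q, chart_dom p q -> chartV p (chart p q) = q;
  chartVK : forall p x, chart_cod p x -> chart p (chartV p x) = x;
  chart_continuous : forall p q, chart_dom p q -> {for q, continuous (chart p)};
  chartV_continuous : forall p x, chart_cod p x -> {for x, continuous (chartV p)};
  chart_transition : forall p q,
    smooth_on (chart_cod p `&` [set x | chart_dom q (chartV p x)])
              (chart q \o chartV p)
}.

#[short(type="manifoldType")]
HB.structure Definition Manifold (R : realType) (n : nat) :=
  {M of Topological M & isManifold R n M}.

Local Open Scope group_scope.

HB.mixin Record isLieGroup (R : realType) (n : nat) G
    of Group G & Manifold R n G := {
  lie_mul_continuous : continuous (fun z : G * G => z.1 * z.2);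
  lie_inv_continuous : continuous (fun x : G => x^-1);
  lie_mul_smooth : forall p q r : G,
    smooth_on
      [set z : 'rV[R]_n * 'rV[R]_n | [/\ chart_cod p z.1, chart_cod q z.2 &
         chart_dom r ((chartV p z.1 : G) * chartV q z.2)]]
      (fun z => chart r ((chartV p z.1 : G) * chartV q z.2));
  lie_inv_smooth : forall p r : G,
    smooth_on
      [set x : 'rV[R]_n | chart_cod p x /\ chart_dom r (chartV p x : G)^-1]
      (fun x => chart r (chartV p x : G)^-1)
}.

#[short(type="lieGroupType")]
HB.structure Definition LieGroup (R : realType) (n : nat) :=
  {G of Group G & Manifold R n G & isLieGroup R n G}.

Local Close Scope group_scope.

Section Manifolds.
Context {R : realType} {n : nat} {M : manifoldType R n}.

(* The tangent space at p is represented by 'rV[R]_n, a tangent vector at p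
   being given by its coordinates in the preferred chart at p. *)
Definition tangent_map (f : M -> M) (p : M) (v : 'rV[R]_n) : 'rV[R]_n :=
  'd (chart (f p) \o f \o chartV p) (chart p p) v.

(* coordinates, in chart p, of the tangent vector v at q *)
Definition to_chart (p q : M) (v : 'rV[R]_n) : 'rV[R]_n :=
  'd (chart p \o chartV q) (chart q q) v.

(* the tangent vector at q whose coordinates in chart p are v *)
Definition of_chart (p q : M) (v : 'rV[R]_n) : 'rV[R]_n :=
  'd (chart q \o chartV p) (chart p q) v.

(* A vector field is a map X : M -> 'rV[R]_n, X p being a tangent vector at p.
   Its coordinates in chart p, as a function on chart_cod p: *)
Definition vfield_coord (p : M) (X : M -> 'rV[R]_n) (x : 'rV[R]_n) : 'rV[R]_n :=
  to_chart p (chartV p x) (X (chartV p x)).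

Definition smooth_vfield (X : M -> 'rV[R]_n) : Prop :=
  forall p, smooth_on (chart_cod p) (vfield_coord p X).

(* [X, Y]^j = X^i d_i Y^j - Y^i d_i X^j in the chart at p *)
Definition vfield_bracket (X Y : M -> 'rV[R]_n) : M -> 'rV[R]_n := fun p =>
  'd (vfield_coord p Y) (chart p p) (X p) -
  'd (vfield_coord p X) (chart p p) (Y p).

End Manifolds.

(* ip is a positive-definite inner product on the linear subspace A of V; its
   values outside A are irrelevant. *)
Record inner_product_on (R : realType) (V : lmodType R) (A : set V)
    (ip : V -> V -> R) : Prop := {
  ip_sym : forall x y, A x -> A y -> ip x y = ip y x;
  ip_linear : forall a x y z, A x -> A y -> A z ->
    ip (a *: x + y) z = a * ip x z + ip y z;
  ip_posdef : forall x, A x -> x <> 0 -> 0 < ip x x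
}.

Section Metrics.
Context {R : realType} {n : nat} {M : manifoldType R n}.
Implicit Types g : M -> 'rV[R]_n -> 'rV[R]_n -> R.

Record riemannian_metric g : Prop := {
  metric_inner_product : forall p, inner_product_on setT (g p);
  metric_smooth : forall (p : M) (u v : 'rV[R]_n),
    smooth_on (chart_cod p)
      (fun x => let q := chartV p x in g q (of_chart p q u) (of_chart p q v) : R^o)
}.

(* Only the pullback condition f^* g = g is required: this is applied to
   translations of a Lie group, which are always diffeomorphisms. *)
Definition isometry g (f : M -> M) : Prop :=
  forall p u v, g (f p) (tangent_map f p u) (tangent_map f p v) = g p u v.

End Metrics.

Section LieGroups.
Context {R : realType} {n : nat} {G : lieGroupType R n}.
Implicit Types (a : G) (X Y Z : G -> 'rV[R]_n).

Definition left_translation a : G -> G := fun x => (a * x)%g.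
Definition right_translation a : G -> G := fun x => (x * a)%g.

Definition left_invariant_vfield X : Prop :=
  forall a p, X (left_translation a p) = tangent_map (left_translation a) p (X p).

Definition left_invariant_metric (g : G -> 'rV[R]_n -> 'rV[R]_n -> R) : Prop :=
  forall a, isometry g (left_translation a).

Definition bi_invariant_metric (g : G -> 'rV[R]_n -> 'rV[R]_n -> R) : Prop :=
  forall a, isometry g (left_translation a) /\ isometry g (right_translation a).

End LieGroups.

(* A linear subspace of the space of all sections, with the pointwise
   operations, which is closed under vfield_bracket. *)
Definition lie_algebra (R : realType) (n : nat) (G : lieGroupType R n) :
    set (G -> 'rV[R]_n) :=
  [set X | smooth_vfield X /\ left_invariant_vfield X].
Arguments lie_algebra {R n} G _.

(* g is the left-invariant Riemannian metric on G corresponding to ip. *)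
Record corresponding_metric (R : realType) (n : nat) (G : lieGroupType R n)
    (ip : (G -> 'rV[R]_n) -> (G -> 'rV[R]_n) -> R)
    (g : G -> 'rV[R]_n -> 'rV[R]_n -> R) : Prop := {
  corr_riemannian : riemannian_metric g;
  corr_left_invariant : left_invariant_metric g;
  corr_eq : forall X Y, lie_algebra G X -> lie_algebra G Y ->
    forall p, g p (X p) (Y p) = ip X Y
}.

(* U is the symmetric part nabla_X Y - 1/2 [X, Y] of the Levi-Civita connection
   of (lie_algebra G, ip); by nondegeneracy of ip, the identity lc_sym_eq
   determines U on lie_algebra G (and makes it symmetric and bilinear). *)
Record levi_civita_sym (R : realType) (n : nat) (G : lieGroupType R n)
    (ip : (G -> 'rV[R]_n) -> (G -> 'rV[R]_n) -> R)
    (U : (G -> 'rV[R]_n) -> (G -> 'rV[R]_n) -> (G -> 'rV[R]_n)) : Prop := {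
  lc_sym_closed : forall X Y, lie_algebra G X -> lie_algebra G Y ->
    lie_algebra G (U X Y);
  lc_sym_eq : forall X Y Z,
    lie_algebra G X -> lie_algebra G Y -> lie_algebra G Z ->
    2 * ip (U X Y) Z =
    ip (vfield_bracket Z X) Y + ip (vfield_bracket Z Y) X
}.

(* Main.v *)
(* The definition of U gives <U(X, X), X> = 0, and polarisation makes the cyclic
   sum of <U(X, Y), Z> vanish.  For the commutative associative product U, an
   idempotent e satisfies <e, e> = <U(e, e), e> = 0, so there is no nonzero
   idempotent and, in finite dimension, every element is nilpotent.  If
   x^(N+1) = 0 with N >= 2, the cyclic identity for x, x^(N-1), x^N reads
   <x^N, x^N> = 0; descending, x^2 = 0 for all x, hence U = 0.

   U = 0 means that ad_Z is skew for all Z.  Consider, for u and v tangent at 1,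
   the function f(a) = g_a(dR_a u, dR_a v).  With the multiplication written
   m(x, y) in the chart at 1, the left- and right-invariant fields extending u
   are D_2 m(x, 1) u and D_1 m(1, x) u, so by symmetry of second derivatives
   their derivatives at 1 differ by a bracket; since g is constant on pairs of
   left-invariant fields, df(Z) = - <[Z, u], v> - <u, [Z, v]> = 0 at 1.
   Left-invariance of g moves this to every point (with other u and v), so f is
   locally constant, hence constant on the connected group G, and right
   translations are isometries. *)
Require Import Defs.
From HB Require Import structures.
From mathcomp Require Import all_boot all_order all_algebra.
From mathcomp Require Import all_classical all_reals all_analysis.
From mathcomp Require Import ring lra.

Set Implicit Arguments.
Unset Strict Implicit.
Unset Printing Implicit Defensive.

Import Order.TTheory GRing.Theory Num.Theory.
Import numFieldNormedType.Exports.

Local Open Scope classical_set_scope.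
Local Open Scope ring_scope.

(** * Commutative associative algebras with a positive-definite form [q] such that [q (mu x x) x]
    vanishes *)

Section CommutativeAlgebra.
Context {R : realFieldType} {n : nat}.
Variables (mu : 'rV[R]_n -> 'rV[R]_n -> 'rV[R]_n) (q : 'rV[R]_n -> 'rV[R]_n -> R).
Hypothesis muC : forall x y, mu x y = mu y x.
Hypothesis muA : forall x y z, mu (mu x y) z = mu x (mu y z).
Hypothesis mu_linear : forall x, linear (mu x).
Hypothesis q_sym : forall x y, q x y = q y x.
Hypothesis q_linear : forall a x y z, q (a *: x + y) z = a * q x z + q y z.
Hypothesis q_posdef : forall x, x <> 0 -> 0 < q x x.
Hypothesis q_cubic : forall x, q (mu x x) x = 0.

Let muD x y z : mu x (y + z) = mu x y + mu x z.
Proof. by have := mu_linear x 1 y z; rewrite !scale1r. Qed.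
Let mu0 x : mu x 0 = 0.
Proof. by apply: (addrI (mu x 0)); rewrite -muD !addr0. Qed.
Let muDl x y z : mu (y + z) x = mu y x + mu z x.
Proof. by rewrite muC muD !(muC x). Qed.
Let qDl x y z : q (x + y) z = q x z + q y z.
Proof. by have := q_linear 1 x y z; rewrite scale1r mul1r. Qed.
Let q0 z : q 0 z = 0.
Proof. by apply: (addrI (q 0 z)); rewrite -qDl !addr0. Qed.
Let qDr x y z : q z (x + y) = q z x + q z y.
Proof. by rewrite q_sym qDl !(q_sym z). Qed.
Let q_eq0 x : q x x = 0 -> x = 0.
Proof. by move=> qx; apply/eqP/negPn/negP => /eqP/q_posdef; rewrite qx ltxx. Qed.

Let cyclic x y z : q (mu x y) z + q (mu y z) x + q (mu z x) y = 0.
Proof.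
(* Polarisation: the values of the cubic form at [u], [v], [u + v] and [u + v + v] separate its part
   quadratic in [u] from its part quadratic in [v]. Polarising once more in [u] gives the cyclic
   sum. *)
have c2 u v : q (mu u u) v + q (mu u v) u *+ 2 = 0.
  have := q_cubic (u + v); have := q_cubic (u + v + v).
  have := q_cubic u; have := q_cubic v.
  rewrite !(muDl, muD) !(qDl, qDr) (muC v u); lra.
have := c2 (x + y) z; have := c2 x z; have := c2 y z.
rewrite !(muDl, muD) !(qDl, qDr) (muC y x) (muC z x); lra.
Qed.

Lemma idempotent_eq0 e : mu e e = e -> e = 0.
Proof. by move=> ee; apply: q_eq0; rewrite -{1}ee q_cubic. Qed.

Let iter_mu k x z : iter k (mu x) (mu x z) = mu (iter k (mu x) x) z.
Proof. by elim: k => //= k ->; rewrite muA. Qed.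

Let iter_mu0 k x : iter k (mu x) 0 = 0.
Proof. by elim: k => //= k ->. Qed.

(* [iter k (mu x) x] is the power x^(k+1).  If the powers of the matrix T of
   mu x have stable row space from T^k on, then x^(k+1) = x T^k = x^(2k+2) y
   for some y, so x^(k+1) y is idempotent, hence zero, hence x^(k+1) = 0. *)
Lemma nilpotent x : exists k, iter k (mu x) x = 0.
Proof.
pose L : {linear 'rV[R]_n -> 'rV[R]_n} :=
  HB.pack (mu x) (GRing.isLinear.Build R _ _ _ (mu x) (mu_linear x)).
have LE y : y *m lin1_mx L = mu x y := mul_rV_lin1 L y.
pose T k := iter k (fun A => A *m lin1_mx L) 1%:M.
have TE k y : y *m T k = iter k (mu x) y.
  elim: k => [|k IH] /=; first by rewrite mulmx1.
  by rewrite mulmxA IH LE.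
have TS k : (T k.+1 <= T k)%MS.
  have -> : T k.+1 = lin1_mx L *m T k.
    elim: k => [|k IH]; first by rewrite /T /= mul1mx mulmx1.
    by rewrite -[T k.+2]/(T k.+1 *m lin1_mx L) {1}IH -mulmxA.
  exact: submxMl.
(* Otherwise the rank, at most [n] at the start, would drop at each of the first n + 1 steps. *)
have [k rk] : exists k, (\rank (T k) <= \rank (T k.+1))%N.
  have [//|no] := boolp.EM (exists k, (\rank (T k) <= \rank (T k.+1))%N).
  have dec k : (\rank (T k) + k <= n)%N.
    elim: k => [|k IH]; first by rewrite addn0 rank_leq_row.
    rewrite addnS (leq_trans _ IH)// -addSn leq_add2r ltnNge.
    by apply/negP => ?; apply: no; exists k.
  by have := dec n.+1; rewrite addnS ltnNge leq_addl.
have eqT : (T k <= T k.+1)%MS by rewrite -(geq_leqif (mxrank_leqif_sup (TS k))).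
have stab j : (T k <= T (j + k)%N)%MS.
  elim: j => // j IH; apply: (submx_trans eqT); exact: submxMr.
(* The exponent is k + 2 + k = 2 (k + 1), so that x^(2k+2) is the square of p = x^(k+1). *)
have /submxP[D DE] := stab k.+2.
have := TE k x; rewrite DE mulmxA TE.
set y := x *m D => xk; set p := iter k (mu x) x in xk *.
have pE : mu p (mu p y) = p.
  by rewrite -[RHS]xk -!iter_mu -!iterSr -iterD addSnnS.
suff py0 : mu p y = 0 by exists k; rewrite -/p -pE py0 mu0.
apply: idempotent_eq0.
by rewrite muA (muC y) -muA pE.
Qed.

Lemma cubic_null_mul_eq0 x y : mu x y = 0.
Proof.
have sq z : mu z z = 0.
  have [k] := nilpotent z.
  case: k => [/= ->//|k]; elim: k => // k IH zk; apply: IH.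
  set w := iter k.+1 (mu z) z in zk *.
  have wz : mu z w = 0 by [].
  (* Here w = z^(k+2). The first term of the cyclic sum is [q w w]; the other two contain the factor
     [mu z w], which is 0. *)
  have := cyclic z (iter k (mu z) z) w.
  rewrite (muC w) wz q0 addr0 -iter_mu wz iter_mu0 q0 addr0.
  exact: q_eq0.
have := sq (x + y); rewrite muD !muDl !sq add0r addr0 (muC y).
by move/eqP; rewrite -mulr2n -scaler_nat scaler_eq0 pnatr_eq0 => /eqP.
Qed.
End CommutativeAlgebra.

(** * Locality of differentials and closure properties of smooth maps *)

Lemma near_eq_is_diff (R : numFieldType) (V W : normedModType R)
    (f g df : V -> W) x :
  {near x, f =1 g} -> is_diff x f df -> is_diff x g df.
Proof.
move=> fg dfx; have fd : differentiable f x by [].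
have fgx : f x = g x := nbhs_singleton fg.
(* The first-order expansion involves only small increments, for which [f] and [g] agree. *)
have gE : g \o shift x = cst (g x) + 'd f x +o_ 0 id.
  apply/eqaddoP => e e0.
  have fg0 : \forall h \near 0, f (h + x) = g (h + x).
    by rewrite (near_shift x); apply: filterS fg => z; rewrite /= sub0r subrK.
  have /eqaddoP/(_ e e0) df0 := diff_locally fd.
  by apply: filterS2 fg0 df0 => h; rewrite !fctE /= fgx => ->.
have dg : 'd g x = 'd f x :> (V -> W)
  by apply: diff_unique gE; exact: diff_continuous.
split; last by rewrite dg diff_val.
by apply/diff_locallyP; rewrite dg; split=> //; exact: diff_continuous.
Qed.

Section SmoothOn.
Context {R : realType}.
Implicit Types (U V W : normedModType R).

Lemma smooth_on_differentiable V W (A : set V) (f : V -> W) x :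
  smooth_on A f -> A x -> differentiable f x.
Proof. by move=> /(_ 1%N)[df _]; exact: df. Qed.

Lemma smooth_on_derive V W (A : set V) (f : V -> W) v :
  smooth_on A f -> smooth_on A ('D_v f).
Proof. by move=> sf k; have [_ ] := sf k.+1; exact. Qed.

Lemma open_eq_is_diff V W (A : set V) (f g df : V -> W) x :
  open A -> A x -> {in A, f =1 g} -> is_diff x f df -> is_diff x g df.
Proof.
move=> oA Ax fg; apply: near_eq_is_diff.
by apply: filterS (open_nbhs_nbhs (conj oA Ax)) => y Ay; apply/fg/mem_set.
Qed.

Lemma open_eq_derive V W (A : set V) (f g : V -> W) x v :
  open A -> A x -> {in A, f =1 g} -> 'D_v f x = 'D_v g x.
Proof.
move=> oA Ax fg; apply: near_eq_derive.
by apply: filterS (open_nbhs_nbhs (conj oA Ax)) => y Ay; apply/fg/mem_set.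
Qed.

(** Coinduction for smoothness: the induction on the order is done once, for functions that agree on
    [A] with a member of [P]. Closure properties of smooth maps then need a single
    differentiation. *)
Lemma smooth_on_coind V W (P : (V -> W) -> Prop) (A : set V) : open A ->
  (forall f, P f -> forall x, A x -> differentiable f x) ->
  (forall f, P f -> forall v, exists2 g, P g & {in A, 'D_v f =1 g}) ->
  forall f, P f -> smooth_on A f.
Proof.
move=> oA Pd PD f Pf k.
have : exists2 g, P g & {in A, g =1 f} by exists f.
elim: k f {Pf} => [|k IH] f [g Pg gf].
  move=> x Ax; apply: differentiable_continuous.
  have dg := differentiableP (Pd _ Pg _ Ax).
  by have := open_eq_is_diff oA Ax gf dg.
split=> [x Ax|v].
  have dg := differentiableP (Pd _ Pg _ Ax).
  by have := open_eq_is_diff oA Ax gf dg.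
apply: IH; have [h Ph Dgh] := PD g Pg v; exists h => // x xA.
by rewrite -Dgh//; apply: open_eq_derive gf => //; exact: set_mem.
Qed.

Lemma smooth_on_eq V W (A : set V) (f g : V -> W) :
  open A -> {in A, f =1 g} -> smooth_on A f -> smooth_on A g.
Proof.
move=> oA fg sf.
apply: (smooth_on_coind (P := fun h => exists2 f, smooth_on A f & {in A, f =1 h}) oA).
- move=> h [{fg}f {}sf fh] x Ax.
  have df := differentiableP (smooth_on_differentiable sf Ax).
  by have := open_eq_is_diff oA Ax fh df.
- move=> h [{fg}f {}sf fh] v; exists ('D_v h) => //.
  exists ('D_v f); first exact: smooth_on_derive.
  by move=> x xA; apply: open_eq_derive fh => //; exact: set_mem.
- by exists f.
Qed.

(** The product rule, from the differential of the continuous bilinear map [a *: w] composed with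
    the pair (f, g). *)
Lemma is_diff_scale V W (f df : V -> R^o) (g dg : V -> W) x :
  is_diff x f df -> is_diff x g dg ->
  is_diff x (fun y => f y *: g y) (fun y => f x *: dg y + df y *: g x).
Proof.
move=> Df Dg.
have scale_bilinear : bilinear_for
    (GRing.Scale.Law.clone _ _ *:%R _) (GRing.Scale.Law.clone _ _ *:%R _)
    (fun (a : R^o) (w : W) => a *: w).
  split=> [w|a] b u v /=; first by rewrite scalerDl -scalerA.
  by rewrite scalerDr scalerA mulrC -scalerA.
pose s : {bilinear R^o -> W -> W} := HB.pack (fun (a : R^o) (w : W) => a *: w)
  (bilinear_isBilinear.Build R R^o W W _ _ _ scale_bilinear).
have cs : continuous (fun p : R^o * W => s p.1 p.2).
  by move=> p; apply: (@scale_continuous R W p).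
have Ds : is_diff (f x, g x) (fun p : R^o * W => s p.1 p.2)
    (fun q => s (f x) q.2 + s q.1 (g x)).
  by split; [exact: differentiable_bilin|rewrite diff_bilin].
exact: (is_diff_comp (f := fun y => (f y, g y))).
Qed.

(** The differential of [l] is the same [L] at every point, so the derivative of [f \o l] along [v]
    has the same form, with ['D_(L v) f] in place of [f]. The maps [l] of interest are the
    inclusions of slices of a product. *)
Lemma smooth_on_precomp U V W (A : set U) (B : set V) (l L : U -> V) (f : V -> W) :
  open A -> (forall x, is_diff x l L) -> (forall x, A x -> B (l x)) ->
  smooth_on B f -> smooth_on A (f \o l).
Proof.
move=> oA dl AB sf.
apply: (smooth_on_coind (P := fun h => exists2 f, smooth_on B f & h = f \o l) oA);
  last by exists f.
  move=> _ [{}f {}sf ->] x /AB Bx; apply: differentiable_comp => //.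
  exact: smooth_on_differentiable Bx.
move=> _ [{}f {}sf ->] v; exists ('D_(L v) f \o l).
  by exists ('D_(L v) f) => //; exact: smooth_on_derive.
move=> x /set_mem/AB Bx; have df := smooth_on_differentiable sf Bx.
rewrite /= !deriveE//; last exact: differentiable_comp.
by rewrite diff_comp//= diff_val.
Qed.

Lemma is_diff_linear V W (L : {linear V -> W}) x : continuous L -> is_diff x L L.
Proof. by move=> cL; split; [exact: linear_differentiable|rewrite diff_lin]. Qed.

Lemma smooth_on_postcomp U V W (A : set U) (f : U -> V) (L : {linear V -> W}) :
  open A -> continuous L -> smooth_on A f -> smooth_on A (L \o f).
Proof.
move=> oA cL sf.
have dL x : is_diff x L L by exact: is_diff_linear.
apply: (smooth_on_coind (P := fun h => exists2 f, smooth_on A f & h = L \o f) oA);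
  last by exists f.
  move=> _ [{}f {}sf ->] x Ax; apply: differentiable_comp => //.
  exact: smooth_on_differentiable Ax.
move=> _ [{}f {}sf ->] v; exists (L \o 'D_v f).
  by exists ('D_v f) => //; exact: smooth_on_derive.
move=> x /set_mem Ax; have df := smooth_on_differentiable sf Ax.
rewrite /= !deriveE//; last exact: differentiable_comp.
by rewrite diff_comp//= diff_val.
Qed.

Lemma smooth_on_coord V n (A : set V) (f : V -> 'rV[R]_n) i :
  open A -> smooth_on A f -> smooth_on A (fun x => f x 0 i : R^o).
Proof.
move=> oA sf.
have clin : linear (fun w : 'rV[R]_n => w 0 i : R^o) by move=> a u v; rewrite !mxE.
pose c : {linear 'rV[R]_n -> R^o} := HB.pack (fun w : 'rV[R]_n => w 0 i : R^o)
  (GRing.isLinear.Build _ _ _ _ _ clin).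
by apply: (smooth_on_postcomp (L := c)) => //; exact: coord_continuous.
Qed.

Lemma smooth_on_continuous V W (A : set V) (f : V -> W) x :
  smooth_on A f -> A x -> {for x, continuous f}.
Proof. by move=> /(_ 0%N); exact. Qed.

(** * The mean value theorem along segments, symmetry of second derivatives, and functions with zero
    differential *)

Lemma segment_MVT V (f : V -> R^o) x v :
  (forall t, 0 <= t <= 1 -> differentiable f (x + t *: v)) ->
  exists2 t, 0 <= t <= 1 & f (x + v) - f x = 'D_v f (x + t *: v).
Proof.
move=> df; pose l (t : R^o) := x + t *: v.
have dl t : is_diff t l ( *:%R^~ v).
  have := is_diffD (is_diff_cst x t) (is_diff_scalel t v).
  by rewrite add0r.
have dg (t : R^o) : 0 <= t <= 1 -> is_diff t (f \o l) (fun s => 'd f (l t) (s *: v)).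
  move=> t01; have := differentiableP (df _ t01) => dft.
  exact: is_diff_comp.
have dg1 (t : R^o) : 0 <= t <= 1 -> is_derive t (1 : R^o) (f \o l) ('D_v f (l t)).
  move=> t01; have dgt := dg _ t01.
  split; first exact: diff_derivable.
  by rewrite deriveE// diff_val scale1r deriveE//; exact: df.
have [|||t] := @MVT_segment R (f \o l) (fun t => 'D_v f (l t)) 0 1.
- by [].
- by move=> t; rewrite in_itv /= => /andP[t0 t1]; apply: dg1; rewrite !ltW.
- apply: derivable_within_continuous => t; rewrite in_itv /= => t01.
  by have := dg1 _ t01.
rewrite in_itv /= => t01; rewrite subr0 mulr1 /l scale1r scale0r addr0 => ft.
by exists t.
Qed.

(** The mean value theorem is applied twice: to the function f(y + v) - f(y) along [u], then to
    ['D_u f] along [v]. *)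
Lemma second_difference V (A : set V) (f : V -> R^o) x u v : smooth_on A f ->
  (forall s t, 0 <= s <= 1 -> 0 <= t <= 1 -> A (x + s *: u + t *: v)) ->
  exists s t, [/\ 0 <= s <= 1, 0 <= t <= 1 &
    f (x + u + v) - f (x + u) - (f (x + v) - f x) =
      'D_v ('D_u f) (x + s *: u + t *: v)].
Proof.
move=> sf Axuv.
have dshift (w y : V) : is_diff y (fun y => y + w) id.
  by have := is_diffD (is_diff_id y) (is_diff_cst w y); rewrite addr0.
have dfs s t : 0 <= s <= 1 -> 0 <= t <= 1 -> differentiable f (x + s *: u + t *: v).
  by move=> s01 t01; exact: smooth_on_differentiable sf (Axuv _ _ s01 t01).
have I0 : 0 <= (0 : R) <= 1 by rewrite lexx ler01.
have I1 : 0 <= (1 : R) <= 1 by rewrite lexx ler01.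
have dfv s : 0 <= s <= 1 ->
    is_diff (x + s *: u) (fun y => f (y + v)) ('d f (x + s *: u + v)).
  move=> s01; have := dfs s 1 s01 I1; rewrite scale1r => /differentiableP d1.
  exact: (is_diff_comp (f := fun y => y + v)).
have df0 s : 0 <= s <= 1 -> differentiable f (x + s *: u).
  by move=> s01; have := dfs s 0 s01 I0; rewrite scale0r addr0.
have dphi s : 0 <= s <= 1 -> is_diff (x + s *: u) (fun y => f (y + v) - f y)
    (fun w => 'd f (x + s *: u + v) w - 'd f (x + s *: u) w).
  move=> s01; have := df0 _ s01 => /differentiableP d0.
  by have dv := dfv _ s01; exact: (is_diffB dv d0).
have [|s s01 Ds] := @segment_MVT V (fun y => f (y + v) - f y) x u.
  by move=> s s01; have := dphi _ s01.
have [|t t01 Dt] := @segment_MVT V ('D_u f) (x + s *: u) v.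
  move=> t t01; apply: (smooth_on_differentiable (smooth_on_derive u sf)).
  exact: Axuv.
exists s, t; split => //; rewrite -Dt Ds.
have dps := dphi _ s01; rewrite deriveE// diff_val !deriveE//; first exact: df0.
by have := dfs s 1 s01 I1; rewrite scale1r.
Qed.

Lemma deriveZ_dir V W (f : V -> W) x a v : differentiable f x ->
  'D_(a *: v) f x = a *: 'D_v f x.
Proof. by move=> df; rewrite !deriveE// linearZ. Qed.

Lemma distr_lt_trans (a b c d e : R) :
  c = d -> `|a - c| < e -> `|b - d| < e -> `|a - b| < e + e.
Proof.
move=> -> ac bd; apply: le_lt_trans (ler_distD d a b) _.
by apply: ltrD => //; rewrite distrC.
Qed.

(** The second difference with steps [h *: u] and [h *: v] is symmetric in [u] and [v], and is h^2
    times either mixed derivative at some point near [x]. By continuity the two mixed derivatives at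
    [x] are closer than [e + e], which was chosen as their distance. *)
Lemma derive_comm_real V (A : set V) (f : V -> R^o) x u v : open A -> A x ->
  smooth_on A f -> 'D_v ('D_u f) x = 'D_u ('D_v f) x.
Proof.
move=> oA Ax sf; apply/eqP; rewrite -subr_eq0; apply/negPn/negP => neq.
pose e := `|'D_v ('D_u f) x - 'D_u ('D_v f) x| / 2.
have e0 : 0 < e by rewrite divr_gt0// normr_gt0.
have cont u' v' : \forall y \near x, `|'D_v' ('D_u' f) x - 'D_v' ('D_u' f) y| < e.
  have := smooth_on_continuous (smooth_on_derive v' (smooth_on_derive u' sf)) Ax.
  by move=> /cvgrPdist_lt; exact.
have /nbhs_ballP[r /= r0 rP] : \forall y \near x,
    A y /\ `|'D_v ('D_u f) x - 'D_v ('D_u f) y| < e /\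
    `|'D_u ('D_v f) x - 'D_u ('D_v f) y| < e.
  apply: filterI; first exact: open_nbhs_nbhs.
  by apply: filterI; exact: cont.
(* This step keeps the parallelogram with sides [h *: u] and [h *: v] at [x] inside the ball of
   radius [r]; the summand 1 makes the denominator positive even for zero vectors. *)
pose h := r / (`|u| + `|v| + 1).
have d0 : 0 < `|u| + `|v| + 1 by rewrite ltr_wpDl// addr_ge0.
have h0 : 0 < h by rewrite divr_gt0.
have inball u' v' s t : `|u'| + `|v'| = `|u| + `|v| -> 0 <= s <= 1 -> 0 <= t <= 1 ->
    ball x r (x + s *: (h *: u') + t *: (h *: v')).
  move=> uv /andP[s0 s1] /andP[t0 t1].
  rewrite -ball_normE /ball_ /= -addrA opprD addNKr normrN.
  apply: (le_lt_trans (ler_normD _ _)); rewrite !normrZ !ger0_norm//; [|exact: ltW..].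
  apply: (@le_lt_trans _ _ (h * (`|u'| + `|v'|))).
    by rewrite mulrDr lerD// ler_piMl// mulr_ge0// ltW.
  by rewrite uv /h mulrAC ltr_pdivrMr// ltr_pM2l// ltrDl.
have key u' v' : `|u'| + `|v'| = `|u| + `|v| -> exists2 p, ball x r p &
   f (x + h *: u' + h *: v') - f (x + h *: u') - (f (x + h *: v') - f x) =
     h * (h * 'D_v' ('D_u' f) p).
  move=> uv; have [|s [t [s01 t01 ->]]] :=
      @second_difference V A f x (h *: u') (h *: v') sf.
    by move=> s t s01 t01; have /rP[//] := inball _ _ _ _ uv s01 t01.
  have pb := inball _ _ _ _ uv s01 t01.
  exists (x + s *: (h *: u') + t *: (h *: v')) => //.
  move: (x + _ + _) pb => p pb; have [Ap _] := rP _ pb.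
  have dp := smooth_on_differentiable (smooth_on_derive u' sf) Ap.
  rewrite (@open_eq_derive _ _ A ('D_(h *: u') f) (h \*: 'D_u' f))//; last first.
    by move=> y /set_mem Ay; rewrite deriveZ_dir//; exact: smooth_on_differentiable Ay.
  by rewrite deriveZ_dir ?deriveZ//; [exact: diff_derivable|exact: differentiableZ].
have [p pb pE] := key u v erefl.
have [p' pb' pE'] := key v u (addrC _ _).
have pp' : 'D_v ('D_u f) p = 'D_u ('D_v f) p'.
  have hn0 : h != 0 by rewrite gt_eqF.
  have swap (a b c d : R) : a - b - (c - d) = a - c - (b - d) by ring.
  move: pE'; rewrite [x + _ + _]addrAC => pE'.
  have /(mulfI hn0)/(mulfI hn0) := etrans (esym pE) (etrans (swap _ _ _ _) pE').
  exact.
have [_ [h1 _]] := rP _ pb; have [_ [_ h2]] := rP _ pb'.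
have := distr_lt_trans pp' h1 h2.
by rewrite /e -splitr ltxx.
Qed.

Lemma derive_comm V n (A : set V) (f : V -> 'rV[R]_n) x u v : open A -> A x ->
  smooth_on A f -> 'D_v ('D_u f) x = 'D_u ('D_v f) x.
Proof.
move=> oA Ax sf.
have dc (g : V -> 'rV[R]_n) w y j : differentiable g y ->
  'D_w g y 0 j = 'D_w (fun z => g z 0 j) y.
  by move=> /diff_derivable dg; rewrite derive_mx// mxE.
apply/rowP => j.
have D u' v' : 'D_v' ('D_u' f) x 0 j = 'D_v' ('D_u' (fun z => f z 0 j : R^o)) x.
  rewrite dc; last exact: smooth_on_differentiable (smooth_on_derive u' sf) Ax.
  apply: open_eq_derive oA Ax _ => y /set_mem Ay.
  by rewrite dc//; exact: smooth_on_differentiable Ay.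
apply: (etrans (D u v)); apply: (etrans _ (esym (D v u))).
by apply: (derive_comm_real _ _ oA Ax); exact: smooth_on_coord.
Qed.

Lemma ball_diff0_cst V (f : V -> R^o) x r :
  (forall y, ball x r y -> is_diff y f 0) -> forall y, ball x r y -> f y = f x.
Proof.
move=> df y xy.
have inball t : 0 <= t <= 1 -> ball x r (x + t *: (y - x)).
  move=> /andP[t0 t1]; move: xy; rewrite -ball_normE /ball_ /= opprD addNKr normrN.
  by rewrite normrZ ger0_norm// distrC => /(le_lt_trans _); apply; rewrite ler_piMl.
have [|t t01] := @segment_MVT V f x (y - x).
  by move=> t /inball /df.
have := df _ (inball _ t01) => dt.
rewrite (_ : x + (y - x) = y); last by rewrite addrC subrK.
by rewrite deriveE// diff_val => /eqP; rewrite subr_eq0 => /eqP.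
Qed.
End SmoothOn.

(** * Derivatives of families of linear maps, and brackets of related vector fields *)

Section LinearFamilies.
Context {R : realType}.
Implicit Types V W : normedModType R.

Lemma is_diff_unique V W (f df df' : V -> W) x :
  is_diff x f df -> is_diff x f df' -> df = df'.
Proof. by move=> [_ <-] [_ <-]. Qed.

Lemma linear_sum_basis n (W : lmodType R) (T : 'rV[R]_n -> W) u : linear T ->
  T u = \sum_j u 0 j *: T (delta_mx 0 j).
Proof.
move=> linT.
pose L : {linear 'rV[R]_n -> W} := HB.pack T (GRing.isLinear.Build _ _ _ _ T linT).
rewrite -[T]/(L : _ -> _) {1}(row_sum_delta u) linear_sum.
by apply: eq_bigr => j _; rewrite linearZ.
Qed.

Lemma is_diff_sum V W n (f df : 'I_n -> V -> W) x :
  (forall i, is_diff x (f i) (df i)) ->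
  is_diff x (fun y => \sum_i f i y) (fun w => \sum_i df i w).
Proof.
move=> Df.
elim: (index_enum _) => [|i r IH].
  under eq_fun do rewrite big_nil; under [X in is_diff _ _ X]eq_fun do rewrite big_nil.
  exact: (is_diff_cst 0 x).
under eq_fun do rewrite big_cons; under [X in is_diff _ _ X]eq_fun do rewrite big_cons.
exact: is_diffD.
Qed.

Lemma is_diff_coord n m (M : 'M[R]_(n, m)) i j :
  is_diff M (fun N : 'M[R]_(n, m) => N i j : R^o) (fun N : 'M[R]_(n, m) => N i j : R^o).
Proof.
have clin : linear (fun w : 'M[R]_(n, m) => w i j : R^o) by move=> a u v; rewrite !mxE.
pose c : {linear 'M[R]_(n, m) -> R^o} := HB.pack (fun w : 'M[R]_(n, m) => w i j : R^o)
  (GRing.isLinear.Build _ _ _ _ _ clin).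
by apply: (@is_diff_linear R _ _ c); exact: coord_continuous.
Qed.

(** The product rule for T_y(a(y)). Differentiability of [T] is known only on each fixed vector, so
    [a y] is expanded in the standard basis and [is_diff_scale] is applied to each summand. *)
Lemma is_diff_apply V W n (A : set V) (T : V -> 'rV[R]_n -> W)
    (a da : V -> 'rV[R]_n) x :
  open A -> A x -> (forall y, A y -> linear (T y)) ->
  (forall u, differentiable (T^~ u) x) -> is_diff x a da ->
  is_diff x (fun y => T y (a y)) (fun w => T x (da w) + 'd (T^~ (a x)) x w).
Proof.
move=> oA Ax linT dT Da.
have Di i : is_diff x (fun y => (a y 0 i : R^o) *: T y (delta_mx 0 i))
    (fun w => (a x 0 i : R^o) *: 'd (T^~ (delta_mx 0 i)) x w +
      (da w 0 i : R^o) *: T x (delta_mx 0 i)).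
  apply: is_diff_scale; last exact: differentiableP.
  exact: (is_diff_comp (g := fun N : 'rV[R]_n => N 0 i : R^o) Da (is_diff_coord _ _ _)).
have E u y : A y -> T y u = \sum_j u 0 j *: T y (delta_mx 0 j).
  by move=> Ay; apply: linear_sum_basis; exact: linT.
have DT : is_diff x (T^~ (a x))
    (fun w => \sum_i a x 0 i *: 'd (T^~ (delta_mx 0 i)) x w).
  apply: (open_eq_is_diff oA Ax (f := fun y => \sum_i a x 0 i *: T y (delta_mx 0 i))).
    by move=> y /set_mem Ay; rewrite -E.
  apply: is_diff_sum => i; apply: is_diffZ; exact: differentiableP.
apply: (open_eq_is_diff oA Ax (f := fun y => \sum_i (a y 0 i) *: T y (delta_mx 0 i))).
  by move=> y /set_mem Ay; rewrite -E.
have := is_diff_sum Di; congr (is_diff _ _ _); apply/funext => w.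
by rewrite diff_val big_split /= [in RHS]addrC -(E (da w)).
Qed.

(* Y' o phi = dphi(Y); differentiating along X produces dphi(dY(X)) and the
   second derivative of phi, which is symmetric. *)
Lemma related_bracket n (A : set 'rV[R]_n) (phi X Y X' Y' : 'rV[R]_n -> 'rV[R]_n) x :
  open A -> A x -> smooth_on A phi ->
  differentiable X x -> differentiable Y x ->
  differentiable X' (phi x) -> differentiable Y' (phi x) ->
  (forall y, A y -> X' (phi y) = 'd phi y (X y)) ->
  (forall y, A y -> Y' (phi y) = 'd phi y (Y y)) ->
  'd Y' (phi x) (X' (phi x)) - 'd X' (phi x) (Y' (phi x)) =
    'd phi x ('d Y x (X x) - 'd X x (Y x)).
Proof.
move=> oA Ax sphi dX dY dX' dY' XX' YY'.
have dphi := smooth_on_differentiable sphi Ax.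
have key (Z Z' : 'rV[R]_n -> 'rV[R]_n) w :
  differentiable Z x -> differentiable Z' (phi x) ->
    (forall y, A y -> Z' (phi y) = 'd phi y (Z y)) ->
    'd Z' (phi x) ('d phi x w) = 'd phi x ('d Z x w) + 'D_w ('D_(Z x) phi) x.
  move=> dZ dZ' ZZ'.
  have dT u y : A y -> differentiable ((fun z => 'd phi z u) : 'rV[R]_n -> 'rV[R]_n) y.
    move=> Ay; have du := smooth_on_differentiable (smooth_on_derive u sphi) Ay.
    have := open_eq_is_diff oA Ay (g := fun z => 'd phi z u) _ (differentiableP du).
    case=> // z /set_mem Az; rewrite deriveE//; exact: smooth_on_differentiable Az.
  have D := is_diff_apply (T := fun y => 'd phi y) oA Ax (fun y _ => linearP _)
    (fun u => dT u x Ax) (differentiableP dZ).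
  have D' : is_diff x (Z' \o phi) ('d Z' (phi x) \o 'd phi x).
    by apply: is_diff_comp; exact: differentiableP.
  have {}D := open_eq_is_diff oA Ax (g := Z' \o phi)
    (fun y yA => esym (ZZ' y (set_mem yA))) D.
  have E : 'd ((fun z => 'd phi z (Z x)) : 'rV[R]_n -> 'rV[R]_n) x w =
      'D_w ('D_(Z x) phi) x.
    have du := smooth_on_differentiable (smooth_on_derive (Z x) sphi) Ax.
    have dE : {in A, 'D_(Z x) phi =1 fun z => 'd phi z (Z x)}.
      by move=> z /set_mem Az; rewrite deriveE//; exact: smooth_on_differentiable Az.
    have [_ dval] := open_eq_is_diff oA Ax dE (differentiableP du).
    by rewrite (deriveE _ du); exact: (congr1 (@^~ w) dval).
  have E1 := congr1 (fun f => f w) (is_diff_unique D' D); cbv beta in E1.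
  apply: (etrans E1).
  exact: (congr1 (fun z => 'd phi x ('d Z x w) + z) E).
rewrite (XX' _ Ax) (YY' _ Ax).
apply: (etrans (congr2 (fun a b => a - b) (key _ _ _ dY dY' YY')
  (key _ _ _ dX dX' XX'))).
have cancel_mid (P Q S S' : 'rV[R]_n) : S = S' -> P + S - (Q + S') = P - Q.
  by move=> ->; rewrite opprD addrACA subrr addr0.
apply: (etrans (cancel_mid _ _ _ _ (derive_comm (Y x) (X x) oA Ax sphi))).
exact/esym/linearB.
Qed.
End LinearFamilies.

(** * Smooth self-maps of a manifold and their differentials in charts *)

Section TangentMaps.
Context {R : realType} {n : nat} {M : manifoldType R n}.
Implicit Types (f g : M -> M) (p q r s : M).

Definition loc p r f : 'rV[R]_n -> 'rV[R]_n := chart r \o f \o chartV p.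

Definition loc_dom p r f : set 'rV[R]_n :=
  chart_cod p `&` [set x | chart_dom r (f (chartV p x))].

(** Continuity is a separate clause because it makes the sets [loc_dom p r f] open. *)
Definition smooth_map f : Prop :=
  continuous f /\ forall p r, smooth_on (loc_dom p r f) (loc p r f).

(* The differential of f at q, in the coordinates of the charts at p and r. *)
Definition tmap p r f q : {linear 'rV[R]_n -> 'rV[R]_n} :=
  'd (loc p r f) (chart p q).

Lemma open_loc_dom p r f : continuous f -> open (loc_dom p r f).
Proof.
move=> cf; rewrite openE => x [px rfx]; apply: filterI.
  exact: (open_nbhs_nbhs (conj (chart_cod_open p) px)).
have : {for x, continuous (f \o chartV p)}.
  by apply: continuous_comp; [exact: chartV_continuous|exact: cf].
apply; exact: (open_nbhs_nbhs (conj (chart_dom_open r) rfx)).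
Qed.

Lemma loc_dom_chart p r f q : chart_dom p q -> chart_dom r (f q) ->
  loc_dom p r f (chart p q).
Proof. by move=> pq rfq; split; [exact: chart_funS|rewrite /= chartK]. Qed.

Lemma is_diff_loc p r f q : smooth_map f -> chart_dom p q -> chart_dom r (f q) ->
  is_diff (chart p q) (loc p r f) (tmap p r f q).
Proof.
move=> [_ sf] pq rfq; apply: differentiableP.
exact: smooth_on_differentiable (sf p r) (loc_dom_chart pq rfq).
Qed.

Lemma smooth_map_id : smooth_map id.
Proof. by split=> [x|p r]; [exact: cvg_id|exact: chart_transition]. Qed.

Lemma tmap_id p q v : chart_dom p q -> tmap p p id q v = v.
Proof.
move=> pq; have [_ dE] : is_diff (chart p q) (loc p p id) id.
  apply: (open_eq_is_diff (A := chart_cod p) (f := id)).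
  - exact: chart_cod_open.
  - exact: chart_funS.
  - by move=> x /set_mem px; rewrite /loc /= chartVK.
by rewrite /tmap dE.
Qed.

(** The chain rule in charts. The point [q'] and the composite [h] enter through equations, so that
    group laws can be passed as arguments instead of being rewritten inside charts and
    differentials. *)
Lemma tmap_comp f g h p s r q q' v : smooth_map f -> smooth_map g ->
  f q = q' -> (forall x, g (f x) = h x) ->
  chart_dom p q -> chart_dom s q' -> chart_dom r (h q) ->
  tmap s r g q' (tmap p s f q v) = tmap p r h q v.
Proof.
move=> sf sg <- /funext <- {q' h} pq sfq rgfq.
have df := is_diff_loc sf pq sfq.
have dg := is_diff_loc sg sfq rgfq.
have locE : chart s (f q) = loc p s f (chart p q) by rewrite /loc /= chartK.
rewrite locE in dg.
have dgf := is_diff_comp df dg.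
have Ax := loc_dom_chart pq sfq.
have locC : {in loc_dom p s f, loc s r g \o loc p s f =1 loc p r (g \o f)}.
  by move=> x /set_mem[px sfx]; rewrite /loc /= chartK.
have [_ dE] := open_eq_is_diff (open_loc_dom sf.1) Ax locC dgf.
exact/esym/(congr1 (fun h => h v) dE).
Qed.

End TangentMaps.

(** * Translations of a Lie group and left-invariant vector fields *)

Section Translations.
Context {R : realType} {n : nat} {G : lieGroupType R n}.
Implicit Types (a b p q r : G) (u v w : 'rV[R]_n).
Local Open Scope group_scope.

Local Notation L := (@left_translation R n G).
Local Notation T := (@right_translation R n G).
Local Notation e := (1 : G).
Local Notation o := (chart e e).

(** The translation is the restriction of the multiplication to a slice: the first factor is read in
    the chart at [a], where it is the constant [chart a a]. *)
Lemma left_translation_smooth a : smooth_map (L a).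
Proof.
have cL : continuous (L a).
  move=> x; apply: (@continuous_comp _ _ _
    (fun x => (a, x)) (fun z : G * G => z.1 * z.2)).
    by apply: cvg_pair; [exact: cvg_cst|exact: cvg_id].
  exact: lie_mul_continuous.
split => // p r.
have dl (x : 'rV[R]_n) : is_diff x (fun y => (chart a a, y))
    (fun y => ((0%R : 'rV[R]_n), y)).
  exact: (is_diff_pair (is_diff_cst _ x) (is_diff_id x)).
have := smooth_on_precomp (open_loc_dom cL) dl _ (lie_mul_smooth a p r).
set F := (_ \o _); have -> : F = loc p r (L a).
  by apply/funext => x; rewrite /F /loc /= chartK//; exact: chart_dom_self.
apply=> x [px rx] /=; rewrite chartK; last exact: chart_dom_self.
by split => //; apply: chart_funS; exact: chart_dom_self.
Qed.

Lemma right_translation_smooth a : smooth_map (T a).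
Proof.
have cT : continuous (T a).
  move=> x; apply: (@continuous_comp _ _ _
    (fun x => (x, a)) (fun z : G * G => z.1 * z.2)).
    by apply: cvg_pair; [exact: cvg_id|exact: cvg_cst].
  exact: lie_mul_continuous.
split => // p r.
have dl (x : 'rV[R]_n) : is_diff x (fun y => (y, chart a a))
    (fun y => (y, (0%R : 'rV[R]_n))).
  exact: (is_diff_pair (is_diff_id x) (is_diff_cst _ x)).
have := smooth_on_precomp (open_loc_dom cT) dl _ (lie_mul_smooth p a r).
set F := (_ \o _); have -> : F = loc p r (T a).
  by apply/funext => x; rewrite /F /loc /= chartK//; exact: chart_dom_self.
apply=> x [px rx] /=; rewrite chartK; last exact: chart_dom_self.
by split => //; apply: chart_funS; exact: chart_dom_self.
Qed.

(** The left-invariant field extending [v]; together with [left_invariant_left_field] it identifies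
    the Lie algebra with the tangent space at the identity. *)
Definition left_field v : G -> 'rV[R]_n := fun a => tmap e a (L a) e v.

Lemma left_translation1 a : L a e = a. Proof. exact: mulg1. Qed.
Lemma right_translation1 a : T a e = a. Proof. exact: mul1g. Qed.

Lemma left_field1 v : left_field v e = v.
Proof.
rewrite /left_field (_ : L e = id); first by apply: tmap_id; exact: chart_dom_self.
by apply/funext => x; exact: mul1g.
Qed.

Lemma left_field_linear : linear left_field.
Proof.
by move=> a u v; apply/funext => b; exact: (linearP (tmap e b (L b) e) a u v).
Qed.

Lemma left_field_left_invariant v : left_invariant_vfield (left_field v).
Proof.
move=> a p; apply/esym.
apply: (tmap_comp v (left_translation_smooth p) (left_translation_smooth a)).
- exact: left_translation1.
- by move=> x; exact: mulgA.
- exact: chart_dom_self.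
- exact: chart_dom_self.
- by rewrite left_translation1; exact: chart_dom_self.
Qed.

Lemma left_invariant_left_field (X : G -> 'rV[R]_n) :
  left_invariant_vfield X -> X = left_field (X e).
Proof.
move=> Xinv; apply/funext => a.
by have := Xinv a e; rewrite left_translation1 => ->;
  rewrite /tangent_map left_translation1.
Qed.

Definition mul_loc p q r (z : 'rV[R]_n * 'rV[R]_n) : 'rV[R]_n :=
  chart r ((chartV p z.1 : G) * chartV q z.2).

Definition mul_dom p q r : set ('rV[R]_n * 'rV[R]_n) :=
  [set z | [/\ chart_cod p z.1, chart_cod q z.2 &
         chart_dom r ((chartV p z.1 : G) * chartV q z.2)]].

Lemma open_mul_dom p q r : open (mul_dom p q r).
Proof.
rewrite openE => -[x y] [px qy rxy].
have c1 : {for (x, y), continuous (fun z : 'rV[R]_n * 'rV[R]_n => (chartV p z.1 : G))}.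
  by apply: (@continuous_comp _ _ _ fst (chartV p));
    [exact: cvg_fst|exact: chartV_continuous].
have c2 : {for (x, y), continuous (fun z : 'rV[R]_n * 'rV[R]_n => (chartV q z.2 : G))}.
  by apply: (@continuous_comp _ _ _ snd (chartV q));
    [exact: cvg_snd|exact: chartV_continuous].
have c : {for (x, y), continuous
    (fun z : 'rV[R]_n * 'rV[R]_n => (chartV p z.1 : G) * chartV q z.2)}.
  apply: (@continuous_comp _ _ _
    (fun z : 'rV[R]_n * 'rV[R]_n => (chartV p z.1 : G, chartV q z.2 : G))
    (fun z : G * G => z.1 * z.2)); last exact: lie_mul_continuous.
  exact: cvg_pair.
have n1 : nbhs (x, y) [set z : 'rV[R]_n * 'rV[R]_n | chart_cod p z.1].
  by apply: (@cvg_fst _ _ (nbhs x) (nbhs y));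
    exact: (open_nbhs_nbhs (conj (chart_cod_open p) px)).
have n2 : nbhs (x, y) [set z : 'rV[R]_n * 'rV[R]_n | chart_cod q z.2].
  by apply: (@cvg_snd _ _ (nbhs x) (nbhs y));
    exact: (open_nbhs_nbhs (conj (chart_cod_open q) qy)).
have n3 := c _ (open_nbhs_nbhs (conj (chart_dom_open r) rxy)).
by apply: filterS3 n1 n2 n3 => z; split.
Qed.

Lemma mul_loc_smooth p q r : smooth_on (mul_dom p q r) (mul_loc p q r).
Proof. exact: lie_mul_smooth. Qed.

Lemma mul_domr p x : chart_cod p x -> mul_dom p e p (x, o).
Proof.
move=> px; split => //=; first exact/chart_funS/chart_dom_self.
by rewrite chartK ?mulg1; [exact: chartV_funS|exact: chart_dom_self].
Qed.

Lemma mul_doml p x : chart_cod p x -> mul_dom e p p (o, x).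
Proof.
move=> px; split => //=; first exact/chart_funS/chart_dom_self.
by rewrite chartK ?mul1g; [exact: chartV_funS|exact: chart_dom_self].
Qed.

(** In charts, left translation by the point with coordinates [x] is a slice of the multiplication.
    This turns an expression in the translation into a partial derivative that depends smoothly on
    [x]. *)
Lemma tmap_left p x v : chart_cod p x ->
  tmap e p (L (chartV p x)) e v = 'D_((0%R : 'rV[R]_n), v) (mul_loc p e p) (x, o).
Proof.
move=> px; have dm := smooth_on_differentiable (@mul_loc_smooth p e p) (mul_domr px).
have dl : is_diff o (fun y => (x, y)) (fun y => ((0%R : 'rV[R]_n), y)).
  exact: (is_diff_pair (is_diff_cst _ _) (is_diff_id _)).
have [_ dE] := is_diff_comp dl (differentiableP dm).
by rewrite (deriveE _ dm) /tmap; exact: (congr1 (fun f => f v) dE).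
Qed.

Lemma tmap_right p x v : chart_cod p x ->
  tmap e p (T (chartV p x)) e v = 'D_(v, (0%R : 'rV[R]_n)) (mul_loc e p p) (o, x).
Proof.
move=> px; have dm := smooth_on_differentiable (@mul_loc_smooth e p p) (mul_doml px).
have dl : is_diff o (fun y => (y, x)) (fun y => (y, (0%R : 'rV[R]_n))).
  exact: (is_diff_pair (is_diff_id _) (is_diff_cst _ _)).
have [_ dE] := is_diff_comp dl (differentiableP dm).
by rewrite (deriveE _ dm) /tmap; exact: (congr1 (fun f => f v) dE).
Qed.

Lemma vfield_coord_left_field p x v : chart_cod p x ->
  vfield_coord p (left_field v) x = tmap e p (L (chartV p x)) e v.
Proof.
move=> px; apply: (tmap_comp v (left_translation_smooth _) smooth_map_id) => //.
- exact: left_translation1.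
- exact: chart_dom_self.
- exact: chart_dom_self.
- by rewrite left_translation1; exact: chartV_funS.
Qed.

Lemma left_field_smooth v : smooth_vfield (left_field v).
Proof.
move=> p.
have dl (x : 'rV[R]_n) : is_diff x (fun y => (y, o)) (fun y => (y, (0%R : 'rV[R]_n))).
  exact: (is_diff_pair (is_diff_id _) (is_diff_cst _ _)).
have := smooth_on_precomp (chart_cod_open p) dl (@mul_domr p)
  (smooth_on_derive ((0%R : 'rV[R]_n), v) (@mul_loc_smooth p e p)).
apply: smooth_on_eq; first exact: chart_cod_open.
by move=> x /set_mem px; rewrite vfield_coord_left_field// tmap_left.
Qed.

Lemma lie_algebra_left_field v : lie_algebra G (left_field v).
Proof. by split; [exact: left_field_smooth|exact: left_field_left_invariant]. Qed.

(** The local expression of left translation by [a] relates the coordinates of each left-invariant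
    field in the chart at [p] to those in the chart at the translated point, and [related_bracket]
    carries this over to brackets. *)
Lemma bracket_left_invariant u v :
  left_invariant_vfield (vfield_bracket (left_field u) (left_field v)).
Proof.
move=> a p; set q := L a p.
have pp := chart_dom_self p; have qq : chart_dom q (L a p) := chart_dom_self q.
have Ax := loc_dom_chart (f := L a) pp qq.
have locE : loc p q (L a) (chart p p) = chart q q by rewrite /loc /= chartK.
have dv r w : differentiable (vfield_coord r (left_field w)) (chart r r).
  apply: smooth_on_differentiable (left_field_smooth w r) _.
  exact/chart_funS/chart_dom_self.
have rel w y : loc_dom p q (L a) y ->
    vfield_coord q (left_field w) (loc p q (L a) y) =
      'd (loc p q (L a)) y (vfield_coord p (left_field w) y).
  move=> [py qy].
  have qcod : chart_cod q (loc p q (L a) y) by exact: chart_funS.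
  rewrite !vfield_coord_left_field//.
  have -> : chartV q (loc p q (L a) y) = L a (chartV p y) by exact: chartK.
  rewrite -[y in 'd _ y](chartVK p y py); apply/esym.
  apply: (tmap_comp w (left_translation_smooth _) (left_translation_smooth a)).
  - exact: left_translation1.
  - by move=> x; exact: mulgA.
  - exact: chart_dom_self.
  - exact: chartV_funS.
  - by rewrite left_translation1.
have coord r w : vfield_coord r (left_field w) (chart r r) = left_field w r.
  rewrite vfield_coord_left_field; last exact/chart_funS/chart_dom_self.
  by rewrite chartK//; exact: chart_dom_self.
have := related_bracket (open_loc_dom (left_translation_smooth a).1) Ax
  ((left_translation_smooth a).2 p q) (dv p u) (dv p v) _ _ (rel u) (rel v).
rewrite locE !coord; apply; exact: dv.
Qed.

End Translations.

(** * The bracket at the identity and the derivatives there of left- and right-invariant fields *)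

Section InvariantMetric.
Context {R : realType} {n : nat} {G : lieGroupType R n}.
Implicit Types (a b p q r : G) (u v w z : 'rV[R]_n).

Local Notation L := (@left_translation R n G).
Local Notation T := (@right_translation R n G).
Local Notation e := (1%g : G).
Local Notation o := (chart e e).
Local Notation left_field := (@left_field R n G).
Local Notation m := (mul_loc e e e).

Lemma unit_cod : chart_cod e o.
Proof. exact/chart_funS/chart_dom_self. Qed.

Definition br u v : 'rV[R]_n := vfield_bracket (left_field u) (left_field v) e.

Lemma bracket_left_field u v :
  vfield_bracket (left_field u) (left_field v) = left_field (br u v).
Proof. exact/left_invariant_left_field/bracket_left_invariant. Qed.

Definition left_coord u : 'rV[R]_n -> 'rV[R]_n := vfield_coord e (left_field u).
Definition right_coord u (x : 'rV[R]_n) : 'rV[R]_n := tmap e e (T (chartV e x)) e u.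

Lemma left_coord_unit u : left_coord u o = u.
Proof.
rewrite /left_coord vfield_coord_left_field; last exact: unit_cod.
by rewrite chartK; [exact: left_field1|exact: chart_dom_self].
Qed.

Lemma right_coord_unit u : right_coord u o = u.
Proof.
rewrite /right_coord chartK; last exact: chart_dom_self.
rewrite (_ : T e = id); first by apply: tmap_id; exact: chart_dom_self.
by apply/funext => x; exact: mulg1.
Qed.

Lemma differentiable_left_coord u : differentiable (left_coord u) o.
Proof. exact: smooth_on_differentiable (left_field_smooth u e) unit_cod. Qed.

Lemma brE u v : br u v = 'd (left_coord v) o u - 'd (left_coord u) o v.
Proof. by rewrite /br /vfield_bracket !left_field1. Qed.

Lemma left_coord_linear z : linear (fun u => 'd (left_coord u) o z).
Proof.
move=> a u v.
have dZ := is_diffZ a (differentiableP (differentiable_left_coord u)).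
have D := is_diffD dZ (differentiableP (differentiable_left_coord v)).
have [_ dE] := D.
have E : left_coord (a *: u + v) = a *: left_coord u + left_coord v.
  apply/funext => x.
  apply: (etrans (congr1 (to_chart e (chartV e x))
    (congr1 (fun f => f (chartV e x)) (@left_field_linear R n G a u v)))).
  exact: linearP.
exact: (etrans (congr1 (fun F : 'rV[R]_n -> 'rV[R]_n => 'd F o z) E)
  (congr1 (fun f => f z) dE)).
Qed.

Lemma br_linear u : linear (br u).
Proof.
move=> a v w; rewrite !brE.
have sub_linear (P P1 P2 Q Q1 Q2 : 'rV[R]_n) : P = a *: P1 + P2 -> Q = a *: Q1 + Q2 ->
    P - Q = a *: (P1 - Q1) + (P2 - Q2).
  by move=> -> ->; rewrite scalerBr opprD addrACA.
exact: sub_linear (left_coord_linear u a v w) (linearP _ a v w).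
Qed.

Lemma left_coord_derive u z :
  'd (left_coord u) o z = 'D_(z, 0) ('D_(0, u) m) (o, o).
Proof.
have dm := smooth_on_differentiable (smooth_on_derive (0, u)
  (@mul_loc_smooth R n G e e e)) (mul_domr unit_cod).
have dl : is_diff o (fun y => (y, o)) (fun y => (y, (0 : 'rV[R]_n))).
  exact: (is_diff_pair (is_diff_id _) (is_diff_cst _ _)).
have D := is_diff_comp dl (differentiableP dm).
have E : {in chart_cod e, 'D_(0, u) m \o (fun y => (y, o)) =1 left_coord u}.
  by move=> x /set_mem ex; rewrite /left_coord vfield_coord_left_field// tmap_left.
have [_ dE] := open_eq_is_diff (chart_cod_open e) unit_cod E D.
by rewrite (deriveE _ dm); exact: (congr1 (fun f => f z) dE).
Qed.

(* By symmetry of the second derivative of the multiplication. *)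
Lemma is_diff_right_coord u :
  is_diff o (right_coord u) (fun z => 'd (left_coord z) o u).
Proof.
have oo := mul_domr unit_cod.
have dm := smooth_on_differentiable (smooth_on_derive (u, 0)
  (@mul_loc_smooth R n G e e e)) oo.
have dl : is_diff o (fun y => (o, y)) (fun y => ((0 : 'rV[R]_n), y)).
  exact: (is_diff_pair (is_diff_cst _ _) (is_diff_id _)).
have D := is_diff_comp dl (differentiableP dm).
have E : {in chart_cod e, 'D_(u, 0) m \o (fun y => (o, y)) =1 right_coord u}.
  by move=> x /set_mem ex; rewrite /right_coord tmap_right.
have := open_eq_is_diff (chart_cod_open e) unit_cod E D.
congr (is_diff _ _ _); apply/funext => z.
apply: (etrans (esym (deriveE (0, z) dm)));
  apply: (etrans _ (esym (left_coord_derive z u))).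
exact: (derive_comm (u, 0 : 'rV[R]_n) (0 : 'rV[R]_n, z)
  (@open_mul_dom R n G e e e) oo (@mul_loc_smooth R n G e e e)).
Qed.

(** * Left-invariant metrics for which the adjoint maps are skew: invariance under right
    translations *)

Variable g : G -> 'rV[R]_n -> 'rV[R]_n -> R.
Hypothesis g_riem : riemannian_metric g.
Hypothesis g_left : left_invariant_metric g.

Lemma metric_sym p u v : g p u v = g p v u.
Proof. exact: (ip_sym (metric_inner_product g_riem p)). Qed.

Lemma metric_linearl p v : linear (fun u => g p u v : R^o).
Proof. by move=> a u w; exact: (ip_linear (metric_inner_product g_riem p)). Qed.

Lemma metric_linearr p u : linear (fun v => g p u v : R^o).
Proof. by move=> a v w; rewrite !(metric_sym p u); exact: metric_linearl. Qed.

Definition metric_coord (x : 'rV[R]_n) u v : R^o :=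
  g (chartV e x) (of_chart e (chartV e x) u) (of_chart e (chartV e x) v).

Lemma metric_coord_linearl x v : linear (metric_coord x ^~ v).
Proof.
move=> a u w.
by rewrite /metric_coord {1}/of_chart linearP; exact: metric_linearl.
Qed.

Lemma metric_coord_linearr x u : linear (metric_coord x u).
Proof.
move=> a v w.
by rewrite /metric_coord {2}/of_chart linearP; exact: metric_linearr.
Qed.

Lemma metric_coord_unit u v : metric_coord o u v = g e u v.
Proof.
rewrite /metric_coord chartK; last exact: chart_dom_self.
by rewrite /of_chart; congr (g _ _ _); apply: (tmap_id (p := e)); exact: chart_dom_self.
Qed.

(** The product rule, by [is_diff_apply] in the second argument and then in the first. The last term
    depends on [a] and [b] only through their values at the identity, so it is the same for left-
    and right-invariant fields. *)
Lemma is_diff_metric_coord (a b da db : 'rV[R]_n -> 'rV[R]_n) :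
  is_diff o a da -> is_diff o b db ->
  is_diff o (fun x => metric_coord x (a x) (b x))
    (fun w => metric_coord o (da w) (b o) +
      (metric_coord o (a o) (db w) + 'd (fun x => metric_coord x (a o) (b o)) o w)).
Proof.
move=> Da Db.
have d u v : differentiable (fun x => metric_coord x u v) o.
  exact: smooth_on_differentiable (metric_smooth g_riem e u v) (unit_cod).
have oA := chart_cod_open e; have Ao := unit_cod.
have Db' u := is_diff_apply (T := fun x => metric_coord x u) oA Ao
  (fun y _ => metric_coord_linearr y u) (d u) Db.
have dT u : differentiable (fun x => metric_coord x u (b x)) o by have := Db' u.
have := is_diff_apply (T := fun x u => metric_coord x u (b x)) oA Ao
  (fun y _ => metric_coord_linearl y (b y)) dT Da.
have [_ dE] := Db' (a o).
by congr (is_diff _ _ _); apply/funext => w; congr (_ + _);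
  exact: (congr1 (fun f => f w) dE).
Qed.

Definition right_field u : G -> 'rV[R]_n := fun a => tmap e a (T a) e u.

(** The function g_a(dR_a u, dR_a v); if it is constant in [a] for all [u] and [v], right
    translations are isometries. *)
Definition right_norm u v a : R^o := g a (right_field u a) (right_field v a).

Lemma right_norm_coord u v x : chart_cod e x ->
  right_norm u v (chartV e x) = metric_coord x (right_coord u x) (right_coord v x).
Proof.
move=> ex; rewrite /right_norm /metric_coord.
have E w : right_field w (chartV e x) = of_chart e (chartV e x) (right_coord w x).
  apply/esym; apply: (tmap_comp w (right_translation_smooth _) smooth_map_id) => //.
  - exact: right_translation1.
  - exact: chart_dom_self.
  - exact: chartV_funS.
  - by rewrite right_translation1; exact: chart_dom_self.
by rewrite (E u) (E v).
Qed.

Lemma left_norm_coord u v x : chart_cod e x ->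
  g (chartV e x) (left_field u (chartV e x)) (left_field v (chartV e x)) =
  metric_coord x (left_coord u x) (left_coord v x).
Proof.
move=> ex; rewrite /metric_coord.
have E w : left_field w (chartV e x) = of_chart e (chartV e x) (left_coord w x).
  rewrite /left_coord vfield_coord_left_field//.
  apply/esym; apply: (tmap_comp w (left_translation_smooth _) smooth_map_id) => //.
  - exact: left_translation1.
  - exact: chart_dom_self.
  - exact: chartV_funS.
  - by rewrite left_translation1; exact: chart_dom_self.
by rewrite (E u) (E v).
Qed.

Lemma left_norm u v a : g a (left_field u a) (left_field v a) = g e u v.
Proof.
have := g_left a e u v.
rewrite /tangent_map; set q := L a e; have -> : q = a by exact: left_translation1.
exact.
Qed.

Hypothesis ad_skew : forall z u v, g e (br z u) v + g e u (br z v) = 0.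

(* Compare with the derivative of the constant function
   [g (left_field u) (left_field v)]: the derivatives of left_coord and
   right_coord differ by a bracket. *)
Lemma is_diff_right_norm_unit u v : is_diff o (right_norm u v \o chartV e) 0.
Proof.
have oA := chart_cod_open e; have Ao := unit_cod.
have Dr := is_diff_metric_coord (is_diff_right_coord u) (is_diff_right_coord v).
have Dl := is_diff_metric_coord (differentiableP (differentiable_left_coord u))
   (differentiableP (differentiable_left_coord v)).
have Er : {in chart_cod e,
  (fun x => metric_coord x (right_coord u x) (right_coord v x)) =1
  right_norm u v \o chartV e}.
  by move=> x /set_mem ex; rewrite /= right_norm_coord.
have El : {in chart_cod e,
  (fun x => metric_coord x (left_coord u x) (left_coord v x)) =1
  cst (g e u v : R^o)}.
  by move=> x /set_mem ex; rewrite -left_norm_coord// left_norm.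
have := open_eq_is_diff oA Ao Er Dr.
have Dl0 := is_diff_unique (open_eq_is_diff oA Ao El Dl) (is_diff_cst _ o).
congr (is_diff _ _ _); apply/funext => w.
have := congr1 (fun f => f w) Dl0; cbv beta.
rewrite !left_coord_unit !right_coord_unit.
set D := 'd _ o w; rewrite !metric_coord_unit => dl.
have linB (f : 'rV[R]_n -> R^o) x y : linear f -> f (x - y) = f x - f y.
  by move=> fl; rewrite addrC -scaleN1r fl scaleN1r addrC.
have subl x y : g e (x - y) v = g e x v - g e y v := linB _ x y (metric_linearl e v).
have subr x y : g e u (x - y) = g e u x - g e u y := linB _ x y (metric_linearr e u).
have sk := ad_skew w u v; rewrite !brE subl subr in sk.
(* The terms [x1], [x2] come from the left-invariant fields, [x3], [x4] from the right-invariant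
   ones, and [d] from the metric coefficients; the second equation is skewness with the brackets
   expanded. *)
have alg (x1 x2 x3 x4 d : R) : x1 + (x2 + d) = 0 -> x1 - x3 + (x2 - x4) = 0 ->
  x3 + (x4 + d) = 0.
  by move=> ? ?; lra.
exact: alg dl sk.
Qed.

(** This is Ad(a^-1) u. *)
Definition pull u a : 'rV[R]_n := tmap a e (L a^-1%g) a (right_field u a).

Lemma left_field_pull u a : left_field (pull u a) a = right_field u a.
Proof.
have aa := chart_dom_self a.
apply: (etrans (tmap_comp (h := id) _ (left_translation_smooth _)
  (left_translation_smooth a) _ _ aa _ aa)).
- exact: mulVg.
- by move=> x; exact: mulVKg.
- exact: chart_dom_self.
- exact: tmap_id.
Qed.

(** Left and right translations commute: dL_a dR_b Ad(a^-1) u = dR_b dL_a Ad(a^-1) u = dR_b dR_a u,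
    and R_b R_a is right translation by ab. The map [h] sends x to axb. *)
Lemma right_field_translate u a b :
  right_field u (L a b) = tangent_map (L a) b (right_field (pull u a) b).
Proof.
have ee := chart_dom_self e; have ab := chart_dom_self (L a b).
pose h x := L a (T b x).
have he : h e = L a b by rewrite /h right_translation1.
apply/esym.
apply: (etrans (tmap_comp (h := h) (pull u a) (right_translation_smooth b)
  (left_translation_smooth a) (right_translation1 b) (fun=> erefl) ee
    (chart_dom_self b) _)).
  by rewrite he.
apply: (etrans (esym (tmap_comp (h := h) (pull u a) (left_translation_smooth a)
  (right_translation_smooth b) (left_translation1 a) _ ee (chart_dom_self a) _))).
- by move=> x; exact/esym/mulgA.
- by rewrite he.
apply: (etrans (congr1 (tmap a (L a b) (T b) a) (left_field_pull u a))).
apply: (tmap_comp u (right_translation_smooth a) (right_translation_smooth b)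
  (right_translation1 a) _ ee (chart_dom_self a)).
- by move=> x; exact/esym/mulgA.
- by rewrite right_translation1.
Qed.

Lemma right_norm_translate u v a b :
  right_norm u v (L a b) = right_norm (pull u a) (pull v a) b.
Proof. by rewrite /right_norm !right_field_translate; exact: g_left. Qed.

(** Left translation by the inverse of [a] moves the point to the identity, at the cost of replacing
    [u] and [v] by [pull u a] and [pull v a]; the chain rule then transports the zero
    differential. *)
Lemma is_diff_right_norm u v p x : chart_cod p x ->
  is_diff x (right_norm u v \o chartV p) 0.
Proof.
move=> px; pose a := chartV p x.
have pa : chart_dom p a by exact: chartV_funS.
have sL := left_translation_smooth a^-1%g.
have ea : L a^-1%g a = e by exact: mulVg.
have eLa : chart_dom e (L a^-1%g a) by rewrite ea; exact: chart_dom_self.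
have Dl := is_diff_loc sL pa eLa.
have Dr := is_diff_right_norm_unit (pull u a) (pull v a).
have Ax := loc_dom_chart pa eLa.
have locE : o = loc p e (L a^-1%g) (chart p a) by rewrite /loc /= chartK// ea.
rewrite locE in Dr.
have D := is_diff_comp Dl Dr.
have E : {in loc_dom p e (L a^-1%g),
    (right_norm (pull u a) (pull v a) \o chartV e) \o loc p e (L a^-1%g) =1
    right_norm u v \o chartV p}.
  move=> y /set_mem[py ey]; rewrite /= /loc /= chartK//.
  by rewrite -right_norm_translate; congr right_norm; exact: mulVKg.
have := open_eq_is_diff (open_loc_dom sL.1) Ax E D.
by rewrite chartVK.
Qed.

Lemma right_norm_locally_cst u v a :
  \forall b \near a, right_norm u v b = right_norm u v a.
Proof.
have aa := chart_dom_self a.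
have /nbhs_ballP[r /= r0 rP] := open_nbhs_nbhs (conj (chart_cod_open a)
  (chart_funS _ _ aa)).
have cst := ball_diff0_cst (fun y ry => is_diff_right_norm u v (rP y ry)).
have n1 := open_nbhs_nbhs (conj (chart_dom_open a) aa).
have n2 : \forall b \near a, ball (chart a a) r (chart a b).
  exact: (chart_continuous _ _ aa) (nbhsx_ballx _ _ r0).
apply: filterS2 n1 n2 => b ab rb.
by have := cst _ rb; rewrite /= !chartK.
Qed.

Hypothesis G_connected : connected [set: G].

Lemma right_norm_cst u v a : right_norm u v a = right_norm u v e.
Proof.
(* The level set through the identity is open and closed, since each point has a neighbourhood on
   which the function is constant. *)
pose B := [set b : G | right_norm u v b = right_norm u v e].
suff -> : right_norm u v a = right_norm u v e by [].
have BP (b c : G) : right_norm u v c = right_norm u v b -> B c = B b.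
  by rewrite /B /= => ->.
have : B = [set: G].
  apply: G_connected; first by exists e.
  - exists B; last by rewrite setTI.
    rewrite openE => b Bb.
    by apply: filterS (right_norm_locally_cst u v b) => c /BP ->.
  - exists B; last by rewrite setTI.
    rewrite -(setCK B); apply: open_closedC; rewrite openE => b Bb.
    by apply: filterS (right_norm_locally_cst u v b) => c /BP; rewrite /setC /= => ->.
by move=> /(congr1 (@^~ a)); rewrite /B /= => ->.
Qed.

(** Every tangent vector at [p] is the value there of a right-invariant field, and the translation
    sends it to the value of the same field at the translated point. Both sides are thus values of
    one constant function. *)
Lemma right_isometry a : Defs.isometry g (T a).
Proof.
move=> p u v; have pp := chart_dom_self p; have ee := chart_dom_self e.
pose w0 w : 'rV[R]_n := tmap p e (T p^-1%g) p w.
have w0p w : right_field (w0 w) p = w.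
  apply: (etrans (tmap_comp (h := id) _ (right_translation_smooth _)
    (right_translation_smooth p) _ _ pp _ pp)).
  - exact: mulgV.
  - by move=> x; exact: mulgVK.
  - exact: chart_dom_self.
  - exact: tmap_id.
have w0pa w : tangent_map (T a) p w = right_field (w0 w) (T a p).
  rewrite -{1}(w0p w).
  apply: (tmap_comp (w0 w) (right_translation_smooth p)
    (right_translation_smooth a) (right_translation1 p) _ ee pp).
  - by move=> x; exact/esym/mulgA.
  - by rewrite right_translation1; exact: chart_dom_self.
rewrite !w0pa -{2}(w0p u) -{2}(w0p v).
exact: etrans (right_norm_cst _ _ _) (esym (right_norm_cst _ _ _)).
Qed.

End InvariantMetric.

(** * The product [U] transported to the tangent space at the identity, and its vanishing *)

Section Main.
Context {R : realType} {n : nat} {G : lieGroupType R n}.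
Implicit Types (u v w : 'rV[R]_n).
Variables (ip : (G -> 'rV[R]_n) -> (G -> 'rV[R]_n) -> R)
  (U : (G -> 'rV[R]_n) -> (G -> 'rV[R]_n) -> (G -> 'rV[R]_n)).
Hypothesis ip_inner : inner_product_on (lie_algebra G) ip.
Hypothesis U_lc : levi_civita_sym ip U.
Hypothesis U_assoc : forall X Y Z,
  lie_algebra G X -> lie_algebra G Y -> lie_algebra G Z -> U (U X Y) Z = U X (U Y Z).

Local Notation e := (1%g : G).
Local Notation left_field := (@left_field R n G).
Local Notation br := (@br R n G).

Let mu u v : 'rV[R]_n := U (left_field u) (left_field v) e.
Let q u v : R := ip (left_field u) (left_field v).

Let mu_left_field u v : U (left_field u) (left_field v) = left_field (mu u v).
Proof.
apply: left_invariant_left_field.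
by have [] := lc_sym_closed U_lc (lie_algebra_left_field u) (lie_algebra_left_field v).
Qed.

Let q_sym u v : q u v = q v u.
Proof. by apply: (ip_sym ip_inner); exact: lie_algebra_left_field. Qed.

Let q_linear a u v w : q (a *: u + v) w = a * q u w + q v w.
Proof.
by rewrite /q left_field_linear; apply: (ip_linear ip_inner);
  exact: lie_algebra_left_field.
Qed.

Let q_posdef u : u <> 0 -> 0 < q u u.
Proof.
move=> u0; apply: (ip_posdef ip_inner); first exact: lie_algebra_left_field.
by move=> /(congr1 (@^~ e)); rewrite left_field1.
Qed.

Let mu_bracket u v w : 2 * q (mu u v) w = q (br w u) v + q (br w v) u.
Proof.
rewrite /q -mu_left_field (lc_sym_eq U_lc); [|exact: lie_algebra_left_field..].
by rewrite !bracket_left_field.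
Qed.

(** By this nondegeneracy the identity [mu_bracket] determines [mu], so that commutativity and
    linearity of [mu] can be read off from its right-hand side. *)
Let q_inj u v : (forall w, q u w = q v w) -> u = v.
Proof.
move=> uv; apply/eqP; rewrite -subr_eq0; apply/negPn/negP => /eqP/q_posdef.
by rewrite {1}(addrC u) -scaleN1r q_linear uv scaleN1r mulN1r addNr ltxx.
Qed.

Let mu_comm u v : mu u v = mu v u.
Proof.
apply: q_inj => w; apply: (@mulfI _ 2); first by rewrite pnatr_eq0.
by rewrite !mu_bracket addrC.
Qed.

Let mu_linear u : linear (mu u).
Proof.
move=> a v v'; apply: q_inj => w; apply: (@mulfI _ 2); first by rewrite pnatr_eq0.
rewrite q_linear mu_bracket mulrDr mulrCA !mu_bracket.
rewrite br_linear q_linear !(q_sym (br w u)) q_linear; ring.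
Qed.

Let mu_eq0 u v : mu u v = 0.
Proof.
apply: (@cubic_null_mul_eq0 R n mu q) => //.
- move=> x y z.
  have := U_assoc (lie_algebra_left_field x) (lie_algebra_left_field y)
    (lie_algebra_left_field z).
  by rewrite !mu_left_field => /(congr1 (@^~ e)); rewrite !left_field1.
- move=> x; apply: (@mulfI _ 2); first by rewrite pnatr_eq0.
  rewrite mu_bracket; have -> : br x x = 0 by rewrite brE subrr.
  (* Linearity with scalar -1 and equal vectors gives [q 0 x = 0]. *)
  by have := q_linear (-1) x x x; rewrite scaleN1r mulN1r !addNr => ->;
    rewrite mulr0 addr0.
Qed.

Lemma U_eq0 X Y : lie_algebra G X -> lie_algebra G Y -> U X Y = 0.
Proof.
move=> [_ /left_invariant_left_field ->] [_ /left_invariant_left_field ->].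
rewrite mu_left_field mu_eq0; apply/funext => a; exact: linear0.
Qed.

(** By [mu_bracket] and symmetry of [q] the left side is [2 * q (mu u v) z], and [mu] vanishes. *)
Lemma ad_skew z u v : q (br z u) v + q u (br z v) = 0.
Proof.
rewrite (q_sym u) -mu_bracket mu_eq0.
by have := q_linear (-1) z z z; rewrite scaleN1r mulN1r !addNr => ->; rewrite mulr0.
Qed.

End Main.

Theorem theorem3p1 (R : realType) (n : nat) (G : lieGroupType R n)
    (G_connected : connected [set: G])
    (ip : (G -> 'rV[R]_n) -> (G -> 'rV[R]_n) -> R)
    (ip_inner : inner_product_on (lie_algebra G) ip)
    (g : G -> 'rV[R]_n -> 'rV[R]_n -> R)
    (g_corr : corresponding_metric ip g)
    (U : (G -> 'rV[R]_n) -> (G -> 'rV[R]_n) -> (G -> 'rV[R]_n))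
    (U_lc : levi_civita_sym ip U)
    (U_assoc : forall X Y Z,
       lie_algebra G X -> lie_algebra G Y -> lie_algebra G Z ->
       U (U X Y) Z = U X (U Y Z)) :
  (forall X Y, lie_algebra G X -> lie_algebra G Y -> U X Y = 0) /\
  bi_invariant_metric g.
Proof.
split; first exact: U_eq0 ip_inner U_lc U_assoc.
have [g_riem g_left g_ip] := g_corr.
(* At the identity the metric is [ip] on left-invariant extensions, which turns skewness for [ip]
   into the hypothesis that [right_isometry] needs. *)
have gE u v : g 1%g u v = ip (left_field u) (left_field v).
  by rewrite -(g_ip _ _ (lie_algebra_left_field u)
    (lie_algebra_left_field v) 1%g) !left_field1.
move=> a; split; first exact: g_left.
apply: right_isometry => // z u v.
by rewrite !gE; exact: (ad_skew ip_inner U_lc U_assoc).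
Qed.
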